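(* Let $0<\alpha\le\infty$, let $E$ be a strongly symmetric Banach function space on $[0,\alpha)$, let $k\in\mathbb{N}$ and let $f\in S_E$. Suppose there exists a function $g\in S_E$ such that $f\prec g$ and $\mu(f)\neq\mu(g)$. Then $\mu(f)$ is not a $k$-extreme point of $B_E$.
   Context: Let $m$ be Lebesgue measure. $L^0[0,\alpha)$ is the space of complex-valued Lebesgue measurable functions on $[0,\alpha)$ (mod a.e. equality). For $f\in L^0[0,\alpha)$, $d(\lambda,f)=m\{t:|f(t)|>\lambda\}$ and $\mu(t,f)=\inf\{s>0:d(s,f)\le t\}$, $t\ge0$, is its decreasing rearrangement. When $\alpha<\infty$, $\mu(t,f)=0$ for $t\ge\alpha$, and $\mu(f)$ is identified with its restriction to $[0,\alpha)$. Write $f\prec g$ if $\int_0^t\mu(f)\le\int_0^t\mu(g)$ for all $t>0$. A Banach space $E\subset L^0[0,\alpha)$ is symmetric if $f\in L^0$, $g\in E$, $\mu(f)\le\mu(g)$ imply $f\in E$ and $\|f\|_E\le\|g\|_E$; it is strongly symmetric if in addition $f,g\in E$, $f\prec g$ imply $\|f\|_E\le\|g\|_E$. For $k\in\mathbb{N}$ and a complex normed space $X$ of dimension at least $k+1$ with unit sphere $S_X$ and closed unit ball $B_X$, a point $x\in S_X$ is a $k$-extreme point of $B_X$ if whenever $x=\frac1{k+1}\sum_{i=1}^{k+1}x_i$ with all $x_i\in S_X$, the elements $x_1,\dots,x_{k+1}$ are linearly dependent. *)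

(* Defs.v *)
From HB Require Import structures.
From mathcomp Require Import all_boot all_order all_algebra.
From mathcomp Require Import all_classical all_reals all_analysis.
From mathcomp Require Export complex.
Set Implicit Arguments.
Unset Strict Implicit.
Unset Printing Implicit Defensive.
Import Order.TTheory GRing.Theory Num.Theory.
Import numFieldNormedType.Exports.
Local Open Scope classical_set_scope.
Local Open Scope ring_scope.
Local Open Scope complex_scope.

Section L0.
Context {R : realType}.
Implicit Types (alpha : \bar R) (f g : R -> R[i]).

Definition dom alpha : set R := [set t | 0 <= t /\ (t%:E < alpha)%E].

(* The domain type [caratheodory_type _] is [R] with the Lebesgue (not just
   Borel) sigma-algebra; it is the one [completed_lebesgue_measure] lives on. *)
Definition L0 alpha : set (R -> R[i]) := [set f |
  let D : set (caratheodory_type ((@wlength R idfun)^*)%mu) := dom alpha in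
  measurable_fun D (fun t => complex.Re (f t)) /\
  measurable_fun D (fun t => complex.Im (f t))].

Definition ae_eq_on alpha f g : Prop :=
  {ae @lebesgue_measure R, forall t, dom alpha t -> f t = g t}.

Definition distribution_fun alpha f (s : R) : \bar R :=
  @completed_lebesgue_measure R [set t | dom alpha t /\ s%:C < `|f t|].

(* Extended-valued: [ereal_inf set0 = +oo], so the value at [t = 0] is [+oo]
   when [f] is unbounded. *)
Definition rearr alpha f (t : R) : \bar R :=
  ereal_inf [set s%:E | s in
    [set s : R | 0 < s /\ (distribution_fun alpha f s <= t%:E)%E]].

(* As an element of L^0: the possible value [+oo] is replaced by [0]. For an
   element of a symmetric space it only occurs at [t = 0], a null set. *)
Definition rearr_fun alpha f : R -> R[i] := fun t => (fine (rearr alpha f t))%:C.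

Definition submajorized alpha f g : Prop := forall t : R, 0 < t ->
  (\int[@lebesgue_measure R]_(s in `[0%R, t]) rearr alpha f s <=
   \int[@lebesgue_measure R]_(s in `[0%R, t]) rearr alpha g s)%E.

End L0.

(* A Banach space that is a linear subspace of L^0[0, alpha): the map
   [rep] picks a representative of each element, so that the last three fields
   say that [x |-> class of (rep x)] is an injective linear map into L^0. *)
Record banach_function_space (R : realType) (alpha : \bar R) := {
  bfs_sort :> completeNormedModType R[i];
  rep : bfs_sort -> R -> R[i];
  rep_L0 : forall x, L0 alpha (rep x);
  rep_linear : forall (a : R[i]) (x y : bfs_sort),
    ae_eq_on alpha (rep (a *: x + y)) (fun t => a * rep x t + rep y t);
  rep_inj : forall x y : bfs_sort, ae_eq_on alpha (rep x) (rep y) -> x = y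
}.

Section Symmetric.
Context {R : realType} {alpha : \bar R}.
Variable E : banach_function_space alpha.

Definition symmetric_space : Prop := forall (f : R -> R[i]) (y : E),
  L0 alpha f ->
  (forall t, 0 <= t -> (rearr alpha f t <= rearr alpha (rep y) t)%E) ->
  exists2 x : E, ae_eq_on alpha (rep x) f & `|x| <= `|y|.

Definition strongly_symmetric_space : Prop :=
  symmetric_space /\
  forall x y : E, submajorized alpha (rep x) (rep y) -> `|x| <= `|y|.

End Symmetric.

Definition linearly_dependent (K : numFieldType) (X : normedModType K) (n : nat)
    (x : 'I_n -> X) : Prop :=
  exists2 c : 'I_n -> K, exists i, c i != 0 & \sum_i c i *: x i = 0.

(* No dimension requirement on [X]: if [\dim X <= k] every point of the unit
   sphere satisfies this. *)
Definition k_extreme (K : numFieldType) (X : normedModType K) (k : nat) (x : X)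
    : Prop :=
  `|x| = 1 /\
  forall y : 'I_k.+1 -> X, (forall i, `|y i| = 1) ->
    x = k.+1%:R^-1 *: \sum_i y i -> linearly_dependent y.

(* Main.v *)
Require Import Defs.
From mathcomp Require Import all_boot all_order all_algebra.
From mathcomp Require Import all_classical all_reals all_analysis.
From mathcomp Require Import measurable_realfun ring lra.
Import Order.TTheory GRing.Theory Num.Theory.
Import numFieldNormedType.Exports.
Local Open Scope classical_set_scope.
Local Open Scope ring_scope.

Set Implicit Arguments.
Unset Strict Implicit.
(** Write [u] and [v] for the rearrangements of [f] and [g], and [F <= G] for
    their primitives from [0], which are concave. By strong symmetry every
    function submajorized by [g] that represents an element of [E] has norm at
    most one. So it suffices to write [u] as the average of [k.+1] linearly
    independent functions [u + h_i] submajorized by [g]: if the average has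
    norm one, then all of them do ([norm1_of_average]).

    Since [u] and [v] differ, [F c < G c] at some [c] inside the domain. The
    perturbations live on a short window [[c, d)], are small and have mean
    zero. They are controlled through the excess over a level: for every
    [s >= 0] the integral of the rearrangement of [w] up to [t] is at most
    [t * s] plus the integral of the positive part of [|w| - s]
    ([integral_rearr_le]). For [w = u] and [s = u t] this bound is [F t]. For
    [w = u + h] a level is chosen for each [t] ([perturbation_window]).

    - For [t <= c] take a level [p] slightly above [u c], or [u t] if that is
      larger. The window lies below the level, so [h] does not change the
      excess. The bound is then the value at [t] of a line touching [F] from
      above; it lies below [G] at the touching point, and at [c] because of
      the gap there, hence in between by concavity of [G].
    - For [t > c], if [u] eventually drops below [u c], take a level [q]
      slightly below [u c], or [u t] if that is smaller. On the window [u]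
      stays above the level, so there [h] changes the excess by its integral,
      which is zero; the touching line is compared with [G] as before.
    - For [t > c], if [u] is constant from [c] on, take the level [u c]. The
      excess changes by at most the integral of [|h|], but now [G - F] is
      nondecreasing on [[c, +oo)] ([tail_slope_le]) and the gap at [c] absorbs
      that change.

    For the [h_i] cut the window into [k.+1] cells and take a multiple of the
    indicator of the [i]-th cell minus the average of all these indicators.
    These functions have mean zero and add up to zero. As [u] is positive
    near [0], to the left of the window, a linear relation between the
    [u + h_i] has coefficients of sum zero, and evaluating it on the cells
    shows that each coefficient vanishes ([balanced_step_independent]). *)

(** * Null sets and the Lebesgue measure *)

Lemma lebesgue_ae2 (R : realType) (P Q S : R -> Prop) :
  {ae @lebesgue_measure R, forall x, P x} ->
  {ae @lebesgue_measure R, forall x, Q x} ->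
  (forall x, P x -> Q x -> S x) -> {ae @lebesgue_measure R, forall x, S x}.
Proof.
move=> aP aQ PQS; apply: filterS2 aP aQ => //.
exact: (ae_filter_ringOfSetsType (@lebesgue_measure R)).
Qed.

Lemma lebesgue_ae (R : realType) (P S : R -> Prop) :
  {ae @lebesgue_measure R, forall x, P x} ->
  (forall x, P x -> S x) -> {ae @lebesgue_measure R, forall x, S x}.
Proof. by move=> aP PS; apply: (lebesgue_ae2 aP aP) => x + _; exact: PS. Qed.

Lemma lebesgue_ae_forall (R : realType) (n : nat) (P : 'I_n -> R -> Prop) :
  (forall i, {ae @lebesgue_measure R, forall x, P i x}) ->
  {ae @lebesgue_measure R, forall x, forall i, P i x}.
Proof.
by move=> aP; exact: filter_forall.
Qed.

Lemma ae_pick (R : realType) (P : R -> Prop) (a b : R) : a < b ->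
  {ae @lebesgue_measure R, forall x, P x} -> exists2 x, a < x < b & P x.
Proof.
move=> ab [N [mN N0 sN]]; apply: contrapT => H.
have sub : `]a, b[%classic `<=` N.
  move=> x /=; rewrite in_itv/= => axb; apply: sN => Px; apply: H.
  by exists x.
have : (lebesgue_measure (`]a, b[%classic : set R) <= 0)%E.
  by rewrite -N0; apply: le_outer_measure.
by rewrite lebesgue_measure_itv/= lte_fin ab -EFinB lee_fin leNgt subr_gt0 ab.
Qed.

Lemma lebesgue_measure_co_le (R : realType) (b : \bar R) : (0 <= b)%E ->
  (lebesgue_measure ([set x : R | (0 <= x)%R /\ (x%:E < b)%E]) <= b)%E.
Proof.
case: b => [b| |//] b0; last by rewrite leey.
rewrite (_ : [set _ | _] = `[0, b[%classic).
  rewrite lebesgue_measure_itv/= lte_fin; case: ltP => // _.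
  by rewrite -EFinB subr0.
apply/seteqP; split => x /=; rewrite in_itv/= lte_fin; first by case=> -> ->.
by move=> /andP.
Qed.

Lemma measurable_dom (R : realType) (alpha : \bar R) :
  measurable (dom alpha : set R).
Proof.
apply: is_interval_measurable => x y [x0 _] [_ ya] z /andP[xz zy]; split.
  exact: le_trans xz.
by apply: le_lt_trans ya; rewrite lee_fin.
Qed.

(** * Rearrangements *)

Lemma normc_real (R : realType) (x : R) : (`|x%:C| = `|x|%:C)%C.
Proof. by rewrite normc_def /= expr0n /= addr0 sqrtr_sqr. Qed.

Lemma rearr_ge0 (R : realType) (alpha : \bar R) (f : R -> R[i]) (x : R) :
  (0 <= rearr alpha f x)%E.
Proof. by apply: le_ereal_inf_tmp => _ [s [s0 _] <-]; rewrite lee_fin ltW. Qed.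

Lemma rearr_nonincreasing (R : realType) (alpha : \bar R) (f : R -> R[i])
  (x y : R) : x <= y -> (rearr alpha f y <= rearr alpha f x)%E.
Proof.
move=> xy; apply: ereal_inf_le_tmp => _ [s [s0 ds] <-].
by exists s => //; split => //; apply: le_trans ds _; rewrite lee_fin.
Qed.

Lemma distribution_fun_le (R : realType) (alpha : \bar R) (f g : R -> R[i])
    (s t : R) :
  (forall x, dom alpha x -> (s%:C < `|f x|)%C -> (t%:C < `|g x|)%C) ->
  (distribution_fun alpha f s <= distribution_fun alpha g t)%E.
Proof.
move=> fg; apply: le_outer_measure => x [xa sf]; split => //.
exact: fg.
Qed.

Lemma rearr_le (R : realType) (alpha : \bar R) (f : R -> R[i]) (l x : R) :
  0 <= l -> (distribution_fun alpha f l <= x%:E)%E ->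
  (rearr alpha f x <= l%:E)%E.
Proof.
move=> l0 dl; apply/lee_addgt0Pr => e e0; rewrite -EFinD.
apply: ereal_inf_lbound; exists (l + e) => //; split; first lra.
apply: le_trans dl; apply: distribution_fun_le => y _; apply: lt_trans.
by rewrite ltcR; lra.
Qed.

(** Right-continuity of the rearrangement, in the half that monotonicity does
    not give. It holds because a bound by [x + e] on the measure of a
    superlevel set, for all [e > 0], is a bound by [x]. *)
Lemma rearr_gt_right (R : realType) (alpha : \bar R) (f : R -> R[i]) (r x : R) :
  (r%:E < rearr alpha f x)%E ->
  exists2 e : R, 0 < e & forall y, y < x + e -> (r%:E < rearr alpha f y)%E.
Proof.
move=> rx; apply: contrapT => H.
have key (r' : R) : r < r' -> (rearr alpha f x <= r'%:E)%E.
  move=> rr'.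
  have dr' (e : R) : 0 < e ->
      (distribution_fun alpha f r' <= (x + e)%:E)%E /\ 0 < r'.
    move=> e0; apply: contrapT => H'.
    apply: H; exists e => // y yx; rewrite ltNge; apply/negP => yr.
    have : (rearr alpha f y < r'%:E)%E by apply: le_lt_trans yr _; rewrite lte_fin.
    rewrite /rearr => /ereal_inf_lt [_ [s [s0 ds] <-]]; rewrite lte_fin => sr'.
    apply: H'; split; last exact: lt_trans sr'.
    apply: (@le_trans _ _ y%:E); last by rewrite lee_fin; lra.
    apply: le_trans ds; apply: distribution_fun_le => z _; apply: lt_trans.
    by rewrite ltcR.
  apply: ereal_inf_lbound; exists r' => //; split; first by have [] := dr' 1 ltr01.
  by apply/lee_addgt0Pr => e e0; rewrite -EFinD; have [] := dr' e e0.
have : (rearr alpha f x <= r%:E)%E.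
  by apply/lee_addgt0Pr => e e0; rewrite -EFinD; apply: key; lra.
by rewrite leNgt rx.
Qed.

Lemma rearr_measurable (R : realType) (alpha : \bar R) (f : R -> R[i])
  (D : set R) : measurable D -> measurable_fun D (rearr alpha f).
Proof.
move=> mD; apply: (measurability (@ErealGenOInfty.G R)) => [|/= _ [_] [r] -> <-].
  exact: ErealGenOInfty.measurableE.
apply: measurableI => //.
apply: is_interval_measurable => x y /= + + z /andP[xz zy].
rewrite /= !in_itv /= !andbT => rx ry.
by apply: lt_le_trans ry _; exact: rearr_nonincreasing.
Qed.

Lemma fine_rearr_nonincreasing (R : realType) (alpha : \bar R) (f : R -> R[i])
  (x y : R) : x <= y -> (rearr alpha f x < +oo)%E ->
  fine (rearr alpha f y) <= fine (rearr alpha f x).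
Proof.
move=> xy xoo.
have xfin : rearr alpha f x \is a fin_num by rewrite ge0_fin_numE ?rearr_ge0.
rewrite fine_le//.
by rewrite ge0_fin_numE ?rearr_ge0//; apply: le_lt_trans xoo; exact: rearr_nonincreasing.
exact: rearr_nonincreasing.
Qed.

Lemma measurable_fine_rearr (R : realType) (alpha : \bar R) (f : R -> R[i]) :
  measurable_fun setT (fine \o rearr alpha f).
Proof.
by apply: (measurableT_comp (fine_measurable measurableT)); exact: rearr_measurable.
Qed.

Lemma rearr_outside (R : realType) (alpha : \bar R) (f : R -> R[i]) (t : R) :
  (0 <= alpha)%E -> (alpha <= t%:E)%E -> rearr alpha f t = 0%E.
Proof.
move=> a0 at_; apply/eqP; rewrite eq_le rearr_ge0 andbT.
apply: rearr_le => //; apply: le_trans at_.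
apply: le_trans (lebesgue_measure_co_le a0).
by apply: le_outer_measure => x [[]].
Qed.

(** The measure in the distribution function is an outer measure on all sets,
    so a null set can be discarded without any measurability of [f] or [g]. *)
Lemma eq_rearr (R : realType) (alpha : \bar R) (f g : R -> R[i]) :
  ae_eq_on alpha f g -> rearr alpha f = rearr alpha g.
Proof.
have dle f1 f2 s : ae_eq_on alpha f1 f2 ->
    (distribution_fun alpha f1 s <= distribution_fun alpha f2 s)%E.
  move=> [N [mN N0 sN]].
  apply: (@le_trans _ _ (lebesgue_measure
      ([set t | dom alpha t /\ (s%:C%C < `|f2 t|)%R] `|` N))%E).
    apply: le_outer_measure => x [xD sx].
    have [Nx|Nx] := pselect (N x); [by right|left; split=> //].
    rewrite -(_ : f1 x = f2 x)//; apply: contrapT => H.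
    by apply: Nx; apply: sN => /(_ xD).
  apply: le_trans (outer_measureU2 _ _ _) _.
  by rewrite [X in (_ + X)%E]N0 adde0.
move=> fg.
have gf : ae_eq_on alpha g f.
  by apply: (lebesgue_ae fg) => x H xD; rewrite H.
have dE s : distribution_fun alpha f s = distribution_fun alpha g s.
  by apply/eqP; rewrite eq_le !dle.
by apply/funext => x; rewrite /rearr; under eq_set do rewrite dE.
Qed.

(** Borel sets are Caratheodory measurable, so real functions that are Borel
    measurable on the whole line give elements of [L0]. *)
Lemma L0_real (R : realType) (alpha : \bar R) (W : R -> R) :
  measurable_fun setT W -> L0 alpha (fun x => (W x)%:C%C).
Proof.
move=> mW.
have mc : measurable (dom alpha : set R) by exact: measurable_dom.
split=> [_ Y mY|_ Y mY].
  apply: sub_caratheodory.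
  have := mW measurableT Y mY; rewrite setTI => mWY.
  exact: (measurableI _ _ mc mWY).
have m0 : measurable_fun setT (cst 0 : R -> R) by exact: measurable_cst.
apply: sub_caratheodory.
have := m0 measurableT Y mY; rewrite setTI => mWY.
exact: (measurableI _ _ mc mWY).
Qed.

(** The superlevel set of the rearrangement at [s] lies in the interval from
    [0] of length [distribution_fun alpha f s]. With symmetry this puts the
    rearrangement of an element of [E] into [E]. *)
Lemma rearr_rearr_fun_le (R : realType) (alpha : \bar R) (f : R -> R[i]) (t : R) :
  (rearr alpha (rearr_fun alpha f) t <= rearr alpha f t)%E.
Proof.
apply: ereal_inf_le_tmp => _ [s [s0 ds] <-]; exists s => //; split => //.
apply: le_trans ds.
have d0 : (0 <= distribution_fun alpha f s)%E by exact: measure_ge0.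
apply: le_trans (lebesgue_measure_co_le d0).
apply: le_outer_measure => x [[x0 xa]] sx; split => //.
rewrite ltNge; apply/negP => /(rearr_le (ltW s0)) H.
move: sx; rewrite /rearr_fun normc_real ltcR ltNge => /negP; apply.
case: (rearr alpha f x) H (rearr_ge0 alpha f x) => [r| |]//=.
by rewrite !lee_fin => rs r0; rewrite ger0_norm.
Qed.

(** The rearrangement of [h] is at most [del] and vanishes from [eta] on, while
    that of [f] is at least [del] up to [eta]. With symmetry this puts the
    perturbations into [E]. *)
Lemma rearr_bump_le (R : realType) (alpha : \bar R) (h : R -> R) (f : R -> R[i])
    (c d del eta t : R) :
  c <= d -> d - c <= eta -> 0 <= del -> (del%:E <= rearr alpha f eta)%E ->
  (forall x, `|h x| <= del) -> (forall x, ~~ (c <= x < d) -> h x = 0) ->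
  0 <= t -> (rearr alpha (fun x => (h x)%:C%C) t <= rearr alpha f t)%E.
Proof.
move=> cd dceta del0 delf hdel hsupp t0.
have [etat|teta] := leP eta t.
  apply: le_trans (rearr_ge0 alpha f t).
  apply: rearr_le => //; apply: (@le_trans _ _ (d - c)%:E); last first.
    by rewrite lee_fin; lra.
  apply: (@le_trans _ _ (lebesgue_measure (`[c, d[%classic : set R))).
    apply: le_outer_measure => x [_]; rewrite normc_real ltcR.
    rewrite normr_gt0 => hx /=; rewrite in_itv/=.
    by apply: contraNT hx => /hsupp ->.
  rewrite lebesgue_measure_itv/= lte_fin; case: ltP => // _.
  by rewrite lee_fin subr_ge0.
apply: (@le_trans _ _ del%:E); last first.
  by apply: le_trans delf _; apply: rearr_nonincreasing; exact: ltW.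
apply: rearr_le => //; rewrite /distribution_fun.
rewrite (_ : [set _ | _] = set0) ?measure0 ?lee_fin//.
apply/seteqP; split => x // [_]; rewrite normc_real ltcR.
by rewrite ltNge hdel.
Qed.

(** * Integrals of rearrangements and the excess over a level *)

(** Layer cake: by Tonelli on the region under the graph, each integral is the
    integral over the levels [l] of the measures being compared. *)
Lemma le_integral_distribution (R : realType) (p q : R -> \bar R) :
  measurable_fun setT p -> measurable_fun setT q ->
  (forall x, 0 <= p x)%E -> (forall x, 0 <= q x)%E ->
  (forall l : R, 0 <= l ->
    (lebesgue_measure [set x : R | (l%:E < p x)%E] <=
     lebesgue_measure [set x : R | (l%:E < q x)%E])%E) ->
  (\int[@lebesgue_measure R]_x p x <= \int[@lebesgue_measure R]_x q x)%E.
Proof.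
move=> mp mq p0 q0 pq.
pose T := measurableTypeR R.
pose mu : {sigma_finite_measure set T -> \bar R} := @lebesgue_measure R.
pose A (r : R -> \bar R) : set (T * T) :=
  [set z | 0 <= z.2] `&` [set z | (z.2%:E < r z.1)%E].
have mA r : measurable_fun setT r -> measurable (A r).
  move=> mr; apply: measurableI.
    have := @measurable_snd _ _ T T measurableT `[0, +oo[%classic.
    rewrite setTI => H; rewrite [X in measurable X](_ : _ = snd @^-1` `[0, +oo[).
      by apply: H; exact: measurable_itv.
    by apply/seteqP; split => z /=; rewrite in_itv/= andbT.
  rewrite -[X in measurable X]setTI.
  apply: measurable_lte => //.
    by apply/measurable_EFinP; exact: measurable_snd.
  exact: (measurableT_comp mr measurable_fst).
have cake r : measurable_fun setT r -> (forall x, 0 <= r x)%E ->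
    (\int[mu]_x r x = \int[mu]_l mu (ysection (A r) l))%E.
  move=> mr r0.
  transitivity (\int[mu]_x mu (xsection (A r) x))%E.
    apply: eq_integral => x _; case rx : (r x) (r0 x) => [y| |//] y0.
      rewrite (_ : xsection _ _ = `[0, y[%classic).
        rewrite /mu/= lebesgue_measure_itv/= lte_fin; case: ltP => //.
          by rewrite -EFinB subr0.
        move=> y0'; rewrite (_ : y = 0)//.
        by apply/eqP; rewrite eq_le y0' -lee_fin.
      apply/seteqP; split => l; rewrite /xsection/= inE/= /A/= in_itv/= rx lte_fin.
        by case=> -> ->.
      by move=> /andP.
    rewrite (_ : xsection _ _ = `[0, +oo[%classic).
      by rewrite /mu/= lebesgue_measure_itv/= ltry.
    apply/seteqP; split => l; rewrite /xsection/= inE/= /A/= in_itv/= andbT.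
      by case.
    by move=> l0; rewrite rx ltry.
  have := indic_fubini_tonelli mu mu (mA r mr).
  by rewrite indic_fubini_tonelli_FE ?indic_fubini_tonelli_GE//; exact: mA.
rewrite (cake p) // (cake q) //.
apply: ge0_le_integral => //.
- exact: measurable_fun_ysection (mA p mp).
- exact: measurable_fun_ysection (mA q mq).
- move=> l _; have [l0|l0] := leP 0 l.
    suff H r : ysection (A r) l = [set x | (l%:E < r x)%E] by rewrite !H; exact: pq.
    by apply/seteqP; split => x; rewrite /ysection/= inE/= /A/= => //; case.
  suff H r : ysection (A r) l = set0 by rewrite !H.
  apply/seteqP; split => x //; rewrite /ysection/= inE/= /A/= => -[].
  by rewrite leNgt l0.
Qed.

(** On [[0, t]] the rearrangement is at most [s] plus its excess over [s], and
    by layer cake that excess has no larger integral than the excess of [|W|],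
    because [rearr alpha W x > s + l] only for [x] below the distribution
    function of [W] at [s + l]. *)
Lemma integral_rearr_le (R : realType) (alpha : \bar R) (W : R -> R) (s t : R) :
  measurable_fun setT W -> 0 <= s -> 0 <= t ->
  (\int[@lebesgue_measure R]_(x in `[0%R, t]) rearr alpha (fun x => (W x)%:C%C) x
   <= (t * s)%:E +
      \int[@lebesgue_measure R]_(x in dom alpha) (Num.max (`|W x| - s) 0)%:E)%E.
Proof.
move=> mW s0 t0.
set rho := rearr _ _.
have mrho : measurable_fun setT rho by exact: rearr_measurable.
have mD := measurable_dom alpha.
pose p x := maxe (rho x - s%:E)%E 0%E.
have mp : measurable_fun setT p.
  apply: measurable_maxe => //; apply: emeasurable_funB => //.
have mW2 : measurable_fun setT (fun x => Num.max (`|W x| - s) 0).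
  apply: measurable_maxr => //; apply: measurable_funB => //.
  exact: measurableT_comp.
apply: (@le_trans _ _
  (\int[@lebesgue_measure R]_(x in `[0%R, t]) (s%:E + p x))%E).
  apply: ge0_le_integral => //.
  - by move=> x _; exact: rearr_ge0.
  - exact: measurable_funTS.
  - by apply: emeasurable_funD => //; exact: measurable_funTS.
  - move=> x _; rewrite /p; case: (rho x) (rearr_ge0 alpha (fun x => (W x)%:C%C) x) => [r| |] //= _.
      by rewrite -EFinB -EFin_max -EFinD lee_fin -lerBlDl le_max lexx.
    by rewrite leNye.
rewrite (@ge0_integralD _ (measurableTypeR R) _ _ _ _ (cst s%:E) p) //; last 2 first.
- by move=> x _; rewrite /p le_max lexx orbT.
- exact: measurable_funTS.
rewrite integral_cst//= lebesgue_measure_itv/= lte_fin.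
(* [lebesgue_measure_itv] leaves a case split on [0 < t] *)
rewrite (_ : (s%:E * _)%E = (t * s)%:E); last first.
  by case: ltP => tt; rewrite -?EFinB -?EFinM ?subr0 1?mulrC//;
    rewrite (_ : t = 0) ?mul0r ?mule0//; apply/eqP; rewrite eq_le tt.
rewrite leeD2l//.
rewrite integral_mkcond [leRHS]integral_mkcond.
apply: le_integral_distribution.
- exact/(measurable_restrictT _ _).1/measurable_funTS.
- apply/(measurable_restrictT _ _).1 => //.
  by apply/measurable_EFinP; exact: measurable_funTS.
- by move=> x; apply: erestrict_ge0 => y _; rewrite /p le_max lexx orbT.
- by move=> x; apply: erestrict_ge0 => y _; rewrite lee_fin le_max lexx orbT.
move=> l l0.
apply: (@le_trans _ _ (distribution_fun alpha (fun x => (W x)%:C%C) (s + l))).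
  have d0 : (0 <= distribution_fun alpha (fun x => (W x)%:C%C) (s + l))%E.
    exact: measure_ge0.
  apply: le_trans (lebesgue_measure_co_le d0).
  apply: le_outer_measure => x /=.
  rewrite patchE; case: ifPn; last by rewrite lte_fin ltNge l0.
  rewrite inE/= in_itv/= => /andP[x0 _].
  rewrite /p lt_max [X in _ || X]lte_fin (ltNge l 0) l0 orbF lteBrDl// -EFinD.
  move=> rx; split=> //; rewrite ltNge; apply/negP => /rearr_le.
  by rewrite addr_ge0// => /(_ isT); rewrite leNgt rx.
apply: le_outer_measure => x /= [xD].
rewrite normc_real ltcR => lx.
by rewrite patchE mem_set// lte_fin lt_max ltrBrDl lx.
Qed.

(** * Primitives of nonincreasing functions *)

(** A nonincreasing right-continuous [u] on the positive half-line together
    with its integral [F] from [0]. The mean value bounds are all that is used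
    of the relation between them; they contain the concavity of [F] and allow
    [u] to be unbounded at [0]. *)
Record decreasing_primitive (R : realType) (u F : R -> R) : Prop := {
  dp_ge0 : forall x, 0 < x -> 0 <= u x;
  dp_noninc : forall x y, 0 < x -> x <= y -> u y <= u x;
  dp_right : forall x r, 0 < x -> r < u x ->
    exists2 e, 0 < e & forall y, 0 < y -> y < x + e -> r < u y;
  dp_0 : F 0 = 0;
  dp_lower : forall x y, 0 <= x -> x <= y -> 0 < y ->
    (y - x) * u y <= F y - F x;
  dp_upper : forall x y, 0 < x -> x <= y -> F y - F x <= (y - x) * u x
}.

(** Right-continuity is what gives the second bound at [t] itself. *)
Lemma crossing (R : realType) (u F : R -> R) (p b : R) :
  decreasing_primitive u F -> 0 < b -> u b <= p ->
  exists t : R, [/\ 0 <= t <= b, forall x, 0 < x -> x < t -> p <= u x &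
                  forall x, 0 < x -> t <= x -> u x <= p].
Proof.
move=> dF b0 ubp.
pose S := [set x : R | 0 < x /\ u x <= p].
have Sb : S b by [].
have S0 : lbound S 0 by move=> x [/ltW].
have iS : has_inf S by split; [exists b | exists 0].
have infb : inf S <= b by apply: ge_inf => //; exists 0.
exists (inf S); split.
- by rewrite infb andbT; apply: lb_le_inf => //; exists b.
- move=> x x0 xS; rewrite leNgt; apply/negP => ux.
  have : inf S <= x by apply: ge_inf; [exists 0 | split => //; exact: ltW].
  by rewrite leNgt xS.
- move=> x x0 Sx; rewrite leNgt; apply/negP => ux.
  have [e e0 He] := dp_right dF x0 ux.
  have [y [y0 uy] yx] : exists2 y, S y & y < x + e.
    by apply: inf_lt; [case: iS|lra].
  by have := He _ y0 yx; rewrite ltNge uy.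
Qed.

(** Concavity of [G]: if the slope [s] is at most [v t], then [G] grows at
    least as fast as the line from [x] to [t]; otherwise it grows at most as
    fast from [t] to [y]. *)
Lemma affine_le_primitive (R : realType) (v G : R -> R) (c s x y t : R) :
  decreasing_primitive v G -> 0 <= x -> x <= t -> t <= y -> 0 < t ->
  c + s * x <= G x -> c + s * y <= G y -> c + s * t <= G t.
Proof.
move=> dG x0 xt ty t0 Gx Gy.
have [st|ts] := leP s (v t).
  have := dp_lower dG x0 xt t0; nra.
have := dp_upper dG t0 ty; nra.
Qed.

(** A primitive whose slope is eventually smaller than [u t0] falls below every
    function growing with slope [u t0], so it could not stay above [F]. *)
Lemma tail_slope_le (R : realType) (u F v G : R -> R) (t0 t : R) :
  decreasing_primitive u F -> decreasing_primitive v G ->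
  (forall t, 0 < t -> F t <= G t) -> 0 < t0 ->
  (forall x, t0 <= x -> u t0 <= u x) -> 0 < t -> u t0 <= v t.
Proof.
move=> dF dG FG t00 ut0 t_gt0; rewrite leNgt; apply/negP => vt.
set q := u t0 in ut0 vt *.
pose A := G t - t * q - (F t0 - t0 * q).
have e0 : 0 < q - v t by lra.
(* far enough out for the loss of slope [q - v t] to exceed [A] *)
pose x := t0 + t + `|A| / (q - v t) + 1.
have An : 0 <= `|A| / (q - v t) by apply: divr_ge0 => //; exact: ltW.
have xt0 : t0 <= x by rewrite /x; lra.
have xt : t <= x by rewrite /x; lra.
have x0 : 0 < x by lra.
have H1 := dp_lower dF (ltW t00) xt0 x0.
have H2 := dp_upper dG t_gt0 xt.
have H3 := FG x x0.
have H4 := ut0 x xt0.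
have AA : A <= `|A| by exact: ler_norm.
have H5 : `|A| < (x - t) * (q - v t).
  have -> : (x - t) * (q - v t) = (t0 + 1) * (q - v t) + `|A|.
    by rewrite /x; field; lra.
  nra.
rewrite /A in AA.
have H6 : (x - t0) * q <= (x - t0) * u x by nra.
lra.
Qed.

(** What makes small perturbations of [u] on [[c, d)] harmless. Each [t] gets a
    level [s] and the place [tau] where [u] crosses it, so that
    [F tau + s * (t - tau)] is [t * s] plus the integral of the excess of [u]
    over [s], the upper bound that [s] yields for the integral up to [t].
    The three alternatives say what a perturbation of size [del] and mean
    zero does to that excess: nothing, because [u] stays below [s] on the
    window; nothing, because it stays above [s] there and the perturbation
    averages out; or at most [del * (d - c)], which the gap pays for. *)
Definition level_window (R : realType) (u F G : R -> R) (c d del : R) : Prop :=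
  forall t, 0 < t -> exists s, exists tau,
  [/\ 0 <= s, 0 <= tau, forall x, 0 < x -> x < tau -> s <= u x,
     forall x, 0 < x -> tau <= x -> u x <= s &
   [\/ (forall x, c <= x < d -> u x + del <= s) /\
         F tau + s * (t - tau) <= G t,
       [/\ d <= tau, forall x, c <= x < d -> s + del <= u x &
         F tau + s * (t - tau) <= G t] |
       F tau + s * (t - tau) + del * (d - c) <= G t]].

(** The level for [t] is [u t], except where that would be too close to the
    values of [u] on the window. There it is replaced by a level [p] above or
    [q] below [u t0], with [e1] and [e2] so small that the lines of slope [p]
    and [q] touching [F] still pass below [G] at [t0]. Such a [q] is available
    only if [u] takes values below [u t0]; otherwise [u] is constant from [t0]
    on, and the level [u t0] is paid for by the gap. *)
Lemma perturbation_window (R : realType) (u F v G : R -> R) (t0 b e : R) :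
  decreasing_primitive u F -> decreasing_primitive v G ->
  (forall t, 0 < t -> F t <= G t) ->
  0 < t0 -> t0 < b -> 0 < e -> F t0 < G t0 ->
  exists d, exists del,
    [/\ t0 < d <= b, 0 < del <= e & level_window u F G t0 d del].
Proof.
move=> dF dG FG t00 t0b e0 FGt0.
set s0 := u t0; set gam := G t0 - F t0.
have gam0 : 0 < gam by rewrite /gam; lra.
have s00 : 0 <= s0 by exact: dp_ge0 dF _ t00.
have mono x : t0 <= x -> u x <= s0 by move=> xt; exact: dp_noninc dF _ _ t00 xt.
pose e1 := gam / t0.
have e10 : 0 < e1 by exact: divr_gt0.
have t0e1 : t0 * e1 = gam by rewrite /e1; field; lra.
have FG' t : 0 <= t -> F t <= G t.
  rewrite le_eqVlt => /orP[/eqP<-|]; last exact: FG.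
  by rewrite (dp_0 dF) (dp_0 dG).
pose p := s0 + e1.
(* the levels for [t <= t0], which serve both cases below *)
have left t : 0 < t -> t <= t0 -> exists s, exists tau,
   [/\ p <= s, 0 <= tau, forall x, 0 < x -> x < tau -> s <= u x,
      forall x, 0 < x -> tau <= x -> u x <= s &
      F tau + s * (t - tau) <= G t].
  move=> t_gt0 tt0; have [pt|tp] := leP p (u t).
    exists (u t), t; split => //; [exact: ltW| | | ].
    - by move=> x x0 xt; apply: dp_noninc dF _ _ x0 (ltW xt).
    - by move=> x x0 xt; apply: dp_noninc dF _ _ t_gt0 xt.
    - by rewrite subrr mulr0 addr0; exact: FG.
  have [tau [/andP[tau0 taut] H1 H2]] := crossing dF t_gt0 (ltW tp).
  exists p, tau; split => //.
  have taut0 : tau <= t0 by lra.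
  have L1 := dp_lower dF tau0 taut0 t00.
  rewrite (_ : _ + _ = (F tau - p * tau) + p * t); last by ring.
  apply: (@affine_le_primitive _ v G _ _ tau t0 t) => //.
    by have := FG' tau tau0; lra.
  have L3 : (t0 - tau) * e1 <= t0 * e1 by nra.
  have L4 : p * t0 - p * tau = (t0 - tau) * s0 + (t0 - tau) * e1 by rewrite /p; ring.
  rewrite -/s0 in L1; rewrite /gam in t0e1; lra.
have [[t1 t01 ut1]|const] := pselect (exists2 t1, t0 <= t1 & u t1 < s0).
  (* [e2] is bounded by [gam / (t1 - t0)] because the line of slope [q] touches
     [F] at some point of [[t0, t1]] *)
  have t1t0 : 0 < t1 - t0.
    by move: t01; rewrite le_eqVlt => /orP[/eqP E|]; [move: ut1; rewrite -E /s0 ltxx|lra].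
  have t1_gt0 : 0 < t1 by lra.
  pose e2 := Num.min (gam / (t1 - t0)) ((s0 - u t1) / 2).
  have e20 : 0 < e2 by rewrite /e2 lt_min !divr_gt0//=; lra.
  have e2a : (t1 - t0) * e2 <= gam.
    have : e2 <= gam / (t1 - t0) by rewrite /e2 ge_min lexx.
    by rewrite ler_pdivlMr// mulrC.
  have e2b : e2 <= (s0 - u t1) / 2 by rewrite /e2 ge_min lexx orbT.
  pose q := s0 - e2.
  have u10 := dp_ge0 dF t1_gt0.
  have q0 : 0 <= q by rewrite /q; lra.
  have [eta eta0 Heta] : exists2 eta, 0 < eta & forall y, 0 < y -> y < t0 + eta -> q + e2 / 2 < u y.
    by apply: dp_right dF _ _ t00 _; rewrite /q /s0; lra.
  pose d := Num.min b (t0 + eta).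
  have dt0 : t0 < d by rewrite /d lt_min t0b /=; lra.
  have db : d <= b by rewrite /d ge_min lexx.
  have deta : d <= t0 + eta by rewrite /d ge_min lexx orbT.
  pose del := Num.min e (Num.min e1 (e2 / 2)).
  have del0 : 0 < del by rewrite /del !lt_min e0 e10/=; lra.
  have dele : del <= e by rewrite /del ge_min lexx.
  have dele1 : del <= e1 by rewrite /del !ge_min lexx !orbT.
  have dele2 : del <= e2 / 2 by rewrite /del !ge_min lexx !orbT.
  exists d, del; split; [by rewrite dt0 db|by rewrite del0 dele|].
  move=> t t_gt0; have [tt0|t0t] := leP t t0.
    have [s [tau [ps tau0 H1 H2 H3]]] := left t t_gt0 tt0.
    have s_ge0 : 0 <= s by rewrite /p in ps; lra.
    exists s, tau; split => //; constructor 1; split => // x /andP[tx xd].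
    have := mono x tx; rewrite /p in ps; lra.
  have low s x : s <= q -> t0 <= x < d -> s + del <= u x.
    move=> sq /andP[tx xd]; have x0 : 0 < x by lra.
    have := Heta x x0 (lt_le_trans xd deta); lra.
  have [tq|qt] := leP (u t) q.
    exists (u t), t; split => //; [exact: dp_ge0 dF _ t_gt0|exact: ltW| | | ].
    - by move=> x x0 xt; apply: dp_noninc dF _ _ x0 (ltW xt).
    - by move=> x x0 xt; apply: dp_noninc dF _ _ t_gt0 xt.
    - constructor 2; split.
      + rewrite leNgt; apply/negP => td.
        have := Heta t t_gt0 (lt_le_trans td deta); lra.
      + by move=> x; exact: low.
      + by rewrite subrr mulr0 addr0; exact: FG.
  have ut1q : u t1 <= q by rewrite /q; lra.
  have [tau [/andP[tau0 taut1] H1 H2]] := crossing dF t1_gt0 ut1q.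
  have taut : t <= tau.
    by rewrite leNgt; apply/negP => /ltW/(H2 _ t_gt0); rewrite leNgt qt.
  have dtau : d <= tau.
    rewrite leNgt; apply/negP => td.
    have := Heta tau (lt_le_trans t_gt0 taut) (lt_le_trans td deta).
    have := H2 tau (lt_le_trans t_gt0 taut) (lexx _); lra.
  exists q, tau; split => //; constructor 2; split => //.
    by move=> x; exact: low.
  have taut0 : t0 <= tau by lra.
  have L1 := dp_upper dF t00 taut0.
  rewrite (_ : _ + _ = (F tau - q * tau) + q * t); last by ring.
  apply: (@affine_le_primitive _ v G _ _ t0 tau t) => //; [exact: ltW|exact: ltW| | ].
    have L3 : (tau - t0) * e2 <= (t1 - t0) * e2 by nra.
    have L4 : q * t0 - q * tau = - ((tau - t0) * s0) + (tau - t0) * e2.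
      by rewrite /q; ring.
    rewrite -/s0 in L1; rewrite /gam in e2a; lra.
  by have := FG' tau tau0; lra.
have uc x : t0 <= x -> s0 <= u x.
  by move=> tx; rewrite leNgt; apply/negP => ux; apply: const; exists x.
(* [u] is constant on [[t0, +oo)], so the window may be as long as allowed *)
pose d := b.
pose del := Num.min e (Num.min e1 (gam / (d - t0))).
have dt0 : 0 < d - t0 by rewrite /d; lra.
have del0 : 0 < del by rewrite /del !lt_min e0 e10/= divr_gt0.
have dele : del <= e by rewrite /del ge_min lexx.
have dele1 : del <= e1 by rewrite /del !ge_min lexx !orbT.
have delg : del * (d - t0) <= gam.
  have : del <= gam / (d - t0) by rewrite /del !ge_min lexx !orbT.
  by rewrite ler_pdivlMr.
exists d, del; split; [by rewrite /d t0b lexx|by rewrite del0 dele|].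
move=> t t_gt0; have [tt0|t0t] := leP t t0.
  have [s [tau [ps tau0 H1 H2 H3]]] := left t t_gt0 tt0.
  have s_ge0 : 0 <= s by rewrite /p in ps; lra.
  exists s, tau; split => //; constructor 1; split => // x /andP[tx xd].
  have := mono x tx; rewrite /p in ps; lra.
exists s0, t0; split => //; [exact: ltW| |by move=> x _; exact: mono|].
  by move=> x x0 xt; apply: dp_noninc dF _ _ x0 (ltW xt).
constructor 3.
have vt := tail_slope_le dF dG FG t00 uc t_gt0.
have L1 := dp_lower dG (ltW t00) (ltW t0t) t_gt0.
have L2 : (t - t0) * s0 <= (t - t0) * v t by apply: ler_wpM2l => //; lra.
rewrite /gam in delg; lra.
Qed.

(** * The primitive of a rearrangement *)

Definition rearr_primitive (R : realType) (alpha : \bar R) (f : R -> R[i])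
    (t : R) : R :=
  fine (\int[@lebesgue_measure R]_(s in `[0%R, t]) rearr alpha f s).

Definition locally_integrable_rearr (R : realType) (alpha : \bar R)
    (f : R -> R[i]) : Prop := forall t : R,
  (\int[@lebesgue_measure R]_(s in `[0%R, t]) rearr alpha f s < +oo)%E.

Lemma integral_oc_ge (R : realType) (alpha : \bar R) (f : R -> R[i]) (x y : R) :
  x <= y -> ((y - x)%:E * rearr alpha f y <=
    \int[@lebesgue_measure R]_(s in `]x, y]) rearr alpha f s)%E.
Proof.
move=> xy.
apply: (@le_trans _ _
  (\int[@lebesgue_measure R]_(s in `]x, y]) (cst (rearr alpha f y) s))%E).
  rewrite integral_cst//= lebesgue_measure_itv/= lte_fin muleC.
  case: ltP => yx; first by rewrite EFinB.
  by rewrite (_ : y = x) ?subrr//; apply/eqP; rewrite eq_le xy yx.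
apply: ge0_le_integral => //.
- by move=> s _; exact: rearr_ge0.
- exact: rearr_measurable.
- by move=> s /=; rewrite in_itv/= => /andP[_ sy]; exact: rearr_nonincreasing.
Qed.

Lemma integral_oc_le (R : realType) (alpha : \bar R) (f : R -> R[i]) (x y : R) :
  x <= y -> (\int[@lebesgue_measure R]_(s in `]x, y]) rearr alpha f s <=
    (y - x)%:E * rearr alpha f x)%E.
Proof.
move=> xy.
apply: (@le_trans _ _
  (\int[@lebesgue_measure R]_(s in `]x, y]) (cst (rearr alpha f x) s))%E).
  apply: ge0_le_integral => //.
  - by move=> s _; exact: rearr_ge0.
  - exact: rearr_measurable.
  - move=> s /=; rewrite in_itv/= => /andP[xs _].
    by apply: rearr_nonincreasing; exact: ltW.
rewrite integral_cst//= lebesgue_measure_itv/= lte_fin muleC.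
case: ltP => yx; first by rewrite EFinB.
by rewrite (_ : y = x) ?subrr//; apply/eqP; rewrite eq_le xy yx.
Qed.

Lemma integral_rearr_split (R : realType) (alpha : \bar R) (f : R -> R[i])
    (x y : R) : 0 <= x -> x <= y ->
  (\int[@lebesgue_measure R]_(s in `[0%R, y]) rearr alpha f s =
   \int[@lebesgue_measure R]_(s in `[0%R, x]) rearr alpha f s +
   \int[@lebesgue_measure R]_(s in `]x, y]) rearr alpha f s)%E.
Proof.
move=> x0 xy.
rewrite -ge0_integral_setU //=.
- by rewrite -itv_bndbnd_setU// bnd_simp.
- by apply: rearr_measurable; exact: measurableU.
- by move=> s _; exact: rearr_ge0.
- apply/disj_setPS => s [] /=; rewrite !in_itv/= => /andP[_ sx] /andP[xs _].
  by move: xs; rewrite ltNge sx.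
Qed.

Lemma rearr_fin_num (R : realType) (alpha : \bar R) (f : R -> R[i]) (x : R) :
  locally_integrable_rearr alpha f -> 0 < x -> rearr alpha f x \is a fin_num.
Proof.
move=> lf x0; rewrite ge0_fin_numE ?rearr_ge0//.
rewrite ltey; apply/eqP => rx.
have := integral_oc_ge alpha f (ltW x0).
rewrite rx subr0 gt0_muley ?lte_fin// leye_eq => /eqP H.
have := lf x; rewrite (integral_rearr_split alpha f (lexx 0) (ltW x0)) H.
rewrite addey ?ltxx// -ltNye; apply: (@lt_le_trans _ _ 0%E) => //.
by apply: integral_ge0 => s _; exact: rearr_ge0.
Qed.

Lemma fin_num_integral_rearr (R : realType) (alpha : \bar R) (f : R -> R[i])
    (t : R) : locally_integrable_rearr alpha f ->
  (\int[@lebesgue_measure R]_(s in `[0%R, t]) rearr alpha f s)%E \is a fin_num.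
Proof.
by move=> lf; rewrite ge0_fin_numE ?lf// integral_ge0// => s _; exact: rearr_ge0.
Qed.

Lemma rearr_primitiveB (R : realType) (alpha : \bar R) (f : R -> R[i])
    (x y : R) : locally_integrable_rearr alpha f -> 0 <= x -> x <= y ->
  (rearr_primitive alpha f y - rearr_primitive alpha f x)%:E =
  (\int[@lebesgue_measure R]_(s in `]x, y]) rearr alpha f s)%E.
Proof.
move=> lf x0 xy; rewrite EFinB !fineK ?fin_num_integral_rearr//.
rewrite (integral_rearr_split alpha f x0 xy) addeAC subee ?add0e//.
exact: fin_num_integral_rearr.
Qed.

Lemma rearr_primitiveB_le (R : realType) (alpha : \bar R) (f : R -> R[i])
    (x y : R) : locally_integrable_rearr alpha f ->
  0 <= x -> x <= y -> rearr alpha f x \is a fin_num ->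
  rearr_primitive alpha f y - rearr_primitive alpha f x <=
  (y - x) * fine (rearr alpha f x).
Proof.
move=> lf x0 xy fx; rewrite -lee_fin rearr_primitiveB// EFinM fineK//.
exact: integral_oc_le.
Qed.

Lemma rearr_primitiveP (R : realType) (alpha : \bar R) (f : R -> R[i]) :
  locally_integrable_rearr alpha f ->
  decreasing_primitive (fine \o rearr alpha f) (rearr_primitive alpha f).
Proof.
move=> lf.
have finr x : 0 < x -> rearr alpha f x \is a fin_num by exact: rearr_fin_num.
split => [x x0|x y x0 xy|x r x0 rx| |x y x0 xy y0|x y x0 xy] /=.
- by rewrite fine_ge0// rearr_ge0.
- apply: fine_rearr_nonincreasing => //.
  by rewrite -ge0_fin_numE ?rearr_ge0// finr.
- have rx' : (r%:E < rearr alpha f x)%E by rewrite -[ltRHS]fineK ?finr// lte_fin.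
  have [e e0 He] := rearr_gt_right rx'.
  by exists e => // y y0 /He; rewrite -[ltRHS]fineK ?finr// lte_fin.
- by rewrite /rearr_primitive set_itv1 integral_set1.
- rewrite -lee_fin rearr_primitiveB// EFinM fineK ?finr//.
  exact: integral_oc_ge.
- by apply: rearr_primitiveB_le => //; [exact: ltW|exact: finr].
Qed.

(** Where [rearr alpha g] is strictly larger at [t], it stays larger on an
    interval [[t, y]] by right-continuity, so the increments of the primitives
    differ there and they cannot agree at both ends. *)
Lemma rearr_primitive_neq (R : realType) (alpha : \bar R) (f g : R -> R[i])
    (t : R) :
  locally_integrable_rearr alpha f -> locally_integrable_rearr alpha g ->
  0 <= t -> (t%:E < alpha)%E -> (rearr alpha f t < rearr alpha g t)%E ->
  exists t0, [/\ 0 < t0, (t0%:E < alpha)%E &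
    rearr_primitive alpha f t0 <> rearr_primitive alpha g t0].
Proof.
move=> lf lg t0 ta fg.
have ft : rearr alpha f t \is a fin_num.
  by rewrite ge0_fin_numE ?rearr_ge0//; apply: lt_le_trans fg (leey _).
set a := fine (rearr alpha f t).
have [r ar rg] : exists2 r, a < r & (r%:E < rearr alpha g t)%E.
  move: fg; rewrite -(fineK ft) -/a; case: (rearr alpha g t) => [b| |]// ab.
    by exists ((a + b) / 2); move: ab; rewrite ?lte_fin => ab; lra.
  by exists (a + 1); rewrite ?ltry//; lra.
have [e e0 He] := rearr_gt_right rg.
have [b tb ba] : exists2 b, t < b & (b%:E < alpha)%E.
  case: alpha {f g lf lg fg ft a ar rg He} ta => [q| |]// ta.
    by exists ((t + q) / 2); move: ta; rewrite ?lte_fin => ta; lra.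
  by exists (t + 1); rewrite ?ltry//; lra.
pose y := Num.min b (t + e / 2).
have ty : t < y by rewrite lt_min tb/=; lra.
have y0 : 0 < y by lra.
have yb : y <= b by rewrite ge_min lexx.
have ye : y < t + e.
  have : y <= t + e / 2 by rewrite ge_min lexx orbT.
  lra.
have ya : (y%:E < alpha)%E by apply: le_lt_trans ba; rewrite lee_fin.
have rgy : r <= fine (rearr alpha g y).
  by rewrite -lee_fin fineK ?rearr_fin_num// ltW// He.
have dG := rearr_primitiveP lg.
have L1 := dp_lower dG t0 (ltW ty) y0.
have L2 := rearr_primitiveB_le lf t0 (ltW ty) ft.
have L3 : (y - t) * a < (y - t) * fine (rearr alpha g y).
  by rewrite ltr_pM2l ?subr_gt0//; exact: lt_le_trans ar rgy.
have lt : rearr_primitive alpha f y - rearr_primitive alpha f t <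
    rearr_primitive alpha g y - rearr_primitive alpha g t.
  by apply: le_lt_trans L2 _; apply: lt_le_trans L3 _.
have [Ey|Ny] := pselect (rearr_primitive alpha f y = rearr_primitive alpha g y);
  last exact: (ex_intro _ y (And3 y0 ya Ny)).
exists t; split; [|exact: ta|].
  rewrite lt_neqAle t0 andbT eq_sym; apply/eqP => tE; move: lt.
  by rewrite tE (dp_0 dG) (dp_0 (rearr_primitiveP lf)) Ey ltxx.
by move=> Et; move: lt; rewrite Ey Et ltxx.
Qed.

Lemma rearr_primitive_le (R : realType) (alpha : \bar R) (f g : R -> R[i]) (t : R) :
  locally_integrable_rearr alpha f -> locally_integrable_rearr alpha g ->
  submajorized alpha f g -> 0 < t ->
  rearr_primitive alpha f t <= rearr_primitive alpha g t.
Proof.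
move=> lf lg fg t0.
rewrite /rearr_primitive; apply: fine_le; [| |exact: fg];
  exact: fin_num_integral_rearr.
Qed.

Lemma rearr_primitive_lt (R : realType) (alpha : \bar R) (f g : R -> R[i]) (t : R) :
  (0 <= alpha)%E ->
  locally_integrable_rearr alpha f -> locally_integrable_rearr alpha g ->
  submajorized alpha f g -> 0 <= t -> rearr alpha f t <> rearr alpha g t ->
  exists t0, [/\ 0 < t0, (t0%:E < alpha)%E &
    rearr_primitive alpha f t0 < rearr_primitive alpha g t0].
Proof.
move=> a0 lf lg fg t0 neq.
have ta : (t%:E < alpha)%E.
  rewrite ltNge; apply/negP => ta; apply: neq.
  by rewrite !(rearr_outside _ a0 ta).
have [s [s0 sa ns]] : exists s, [/\ 0 < s, (s%:E < alpha)%E &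
    rearr_primitive alpha f s <> rearr_primitive alpha g s].
  have [lt|ge] := ltP (rearr alpha f t) (rearr alpha g t).
    exact: rearr_primitive_neq lf lg t0 ta lt.
  have lt : (rearr alpha g t < rearr alpha f t)%E.
    by rewrite lt_neqAle ge andbT; apply/eqP => E; apply: neq.
  have [s [s0 sa ns]] := rearr_primitive_neq lg lf t0 ta lt.
  by exists s; split; [exact: s0|exact: sa|move=> E; exact: (ns (esym E))].
exists s; split; [exact: s0|exact: sa|]; rewrite lt_neqAle; apply/andP; split; first by apply/eqP; exact: ns.
exact: (rearr_primitive_le lf lg fg s0).
Qed.

(** * Perturbations that stay submajorized *)

Lemma integral_excess (R : realType) (alpha : \bar R) (f : R -> R[i])
    (s tau : R) : locally_integrable_rearr alpha f -> 0 <= tau ->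
  let g x := (fine (rearr alpha f x) - s)%:E in
  (@lebesgue_measure R).-integrable `]0, tau[ g /\
  (\int[@lebesgue_measure R]_(x in `]0%R, tau[) g x)%E =
  (rearr_primitive alpha f tau - s * tau)%:E.
Proof.
move=> lf tau0 g.
have mI : measurable (`]0, tau[%classic : set (measurableTypeR R)) by exact: measurable_itv.
have Eoo : (\int[@lebesgue_measure R]_(x in `]0%R, tau[) rearr alpha f x =
            (rearr_primitive alpha f tau)%:E)%E.
  rewrite /rearr_primitive fineK ?fin_num_integral_rearr//.
  rewrite -(@integral_itv_bndoo _ 0 tau (rearr alpha f) true false)//.
  exact: rearr_measurable.
have ir : (@lebesgue_measure R).-integrable `]0, tau[ (rearr alpha f).
  apply/integrableP; split; first exact: rearr_measurable.
  under eq_integral do rewrite gee0_abs ?rearr_ge0//.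
  by rewrite Eoo ltry.
have ic : (@lebesgue_measure R).-integrable `]0, tau[ (cst s%:E).
  apply/integrableP; split; first exact: measurable_cst.
  under eq_integral do rewrite /=.
  rewrite integral_cst//= lebesgue_measure_itv/= lte_fin.
  by case: ifPn => _; rewrite ?mule0 ?ltry// -EFinD -EFinM ltry.
have gE x : x \in `]0, tau[%classic -> (rearr alpha f x - cst s%:E x)%E = g x.
  rewrite inE/= in_itv/= => /andP[x0 _].
  by rewrite /g EFinB fineK// rearr_fin_num.
split.
  by apply: (@eq_integrable _ _ _ _ _ mI _ _ gE); exact: integrableB.
transitivity (\int[@lebesgue_measure R]_(x in `]0%R, tau[)
  (rearr alpha f \- cst s%:E) x)%E.
  by apply: eq_integral => x /gE <-.
rewrite (integralB mI ir ic) Eoo integral_cst//= lebesgue_measure_itv/= lte_fin.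
case: ltP => t0; first by rewrite -EFinB subr0.
rewrite (_ : tau = 0) ?mule0 ?mulr0 ?sube0 ?subr0//.
by apply/eqP; rewrite eq_le t0.
Qed.

(** [integral_rearr_le] with the excess of [W] over [s] bounded by the excess
    of [u] over [s] plus a correction [k] of integral [K]. As [u] crosses [s]
    at [tau], its excess integrates to [F tau - s * tau]. *)
Lemma integral_rearr_perturbed (R : realType) (alpha : \bar R) (f : R -> R[i])
    (W k : R -> R) (s tau t K : R) :
  locally_integrable_rearr alpha f -> 0 <= s -> 0 <= tau -> 0 <= t ->
  measurable_fun setT W ->
  (@lebesgue_measure R).-integrable setT (EFin \o k) ->
  (\int[@lebesgue_measure R]_x (k x)%:E)%E = K%:E ->
  let g (x : R) := (if (0 < x) && (x < tau) then fine (rearr alpha f x) - s else 0) + k x in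
  (forall x, 0 <= g x) ->
  (forall x, 0 < x -> dom alpha x -> Num.max (`|W x| - s) 0 <= g x) ->
  (\int[@lebesgue_measure R]_(x in `[0%R, t]) rearr alpha (fun x => (W x)%:C%C) x
   <= (rearr_primitive alpha f tau + s * (t - tau) + K)%:E)%E.
Proof.
move=> lf s0 tau0 t0 mW ik EK g g0 Wg.
apply: le_trans (integral_rearr_le alpha mW s0 t0) _.
have [ig Eg] := integral_excess s lf tau0.
set e := (fun x => (fine _ - _)%:E) in ig Eg.
have mI : measurable (`]0, tau[%classic : set (measurableTypeR R)) by exact: measurable_itv.
have gE : EFin \o g = (fun x => (e \_ `]0%R, tau[) x + (k x)%:E)%E.
  apply/funext => x; rewrite /= /g patchE /e EFinD; congr (_ + _)%E.
  case: ifPn => [H|/negP H]; first by rewrite mem_set//= in_itv.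
  by rewrite memNset//= in_itv.
have ie := (@integrable_mkcond _ (measurableTypeR R) R lebesgue_measure _ e mI).1 ig.
have mm : measurable_fun setT (fun x => Num.max (`|W x| - s) 0).
  apply: measurable_maxr => //; apply: measurable_funB => //.
  exact: measurableT_comp.
have mD := measurable_dom alpha.
have mg : measurable_fun setT (EFin \o g).
  rewrite gE; apply: emeasurable_funD.
    by case/integrableP: ie.
  by case/integrableP: ik.
have Ig : (\int[@lebesgue_measure R]_x (g x)%:E =
           (rearr_primitive alpha f tau - s * tau + K)%:E)%E.
  have -> : (\int[@lebesgue_measure R]_x (g x)%:E =
     \int[@lebesgue_measure R]_x ((e \_ `]0%R, tau[) x + (k x)%:E))%E.
    by congr integral; rewrite -gE.
  by rewrite (integralD measurableT ie ik) -integral_mkcond Eg EK.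
have H : (\int[@lebesgue_measure R]_(x in dom alpha) (Num.max (`|W x| - s) 0)%:E
   <= \int[@lebesgue_measure R]_x (g x)%:E)%E.
  rewrite -(@integral_setD1 _ _ 0); last 2 first.
  - exact: measurableD.
  - by apply: measurable_funTS; apply/measurable_EFinP.
  rewrite integral_mkcond; apply: ge0_le_integral => //.
  - by move=> x _; apply: erestrict_ge0 => y _; rewrite lee_fin le_max lexx orbT.
  - apply/(measurable_restrictT _ _).1 => //; first exact: measurableD.
    by apply: measurable_funTS; apply/measurable_EFinP.
  - move=> x _; rewrite patchE; case: ifPn => [|_]; last by rewrite lee_fin.
    rewrite inE => -[xD x0]; rewrite lee_fin; apply: Wg => //.
    by rewrite lt_neqAle eq_sym; case: xD => -> _; rewrite andbT; apply/eqP.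
apply: (le_trans (leeD2l _ H)); rewrite Ig -EFinD lee_fin.
lra.
Qed.

(** The three alternatives of [level_window] correspond to the corrections
    [0], [h] and [del] times the indicator of the window in
    [integral_rearr_perturbed]. *)
Lemma perturbed_submajorized (R : realType) (alpha : \bar R) (f g : R -> R[i])
    (h : R -> R) (c d del : R) :
  locally_integrable_rearr alpha f -> locally_integrable_rearr alpha g ->
  0 < c -> c < d -> 0 < del ->
  measurable_fun setT h -> (forall x, `|h x| <= del) ->
  (forall x, ~~ (c <= x < d) -> h x = 0) ->
  (\int[@lebesgue_measure R]_x (h x)%:E)%E = 0%E ->
  let u := fine \o rearr alpha f in
  let F := rearr_primitive alpha f in
  level_window u F (rearr_primitive alpha g) c d del ->
  submajorized alpha (fun x => (u x + h x)%:C%C) g.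
Proof.
move=> lf lg c0 cd del0 mh hdel hsupp ih u F Hw t t0.
have fini := fin_num_integral_rearr t lg.
have mW : measurable_fun setT (fun x => u x + h x).
  by apply: measurable_funD => //; exact: measurable_fine_rearr.
have u0 x : 0 <= u x by rewrite /u/= fine_ge0// rearr_ge0.
pose b x := del * \1_(`[c, d[%classic : set R) x.
have mI : measurable (`[c, d[%classic : set (measurableTypeR R)) by exact: measurable_itv.
have bE x : b x = if c <= x < d then del else 0.
  rewrite /b indicE; case: ifPn => [H|/negP H].
    by rewrite mem_set ?mulr1//= in_itv.
  by rewrite memNset ?mulr0//= in_itv.
have hb x : `|h x| <= b x.
  rewrite bE; case: ifPn => // /hsupp ->; by rewrite normr0.
have Ib : (\int[@lebesgue_measure R]_x (b x)%:E)%E = (del * (d - c))%:E.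
  under eq_integral do rewrite /b EFinM.
  rewrite ge0_integralZl//; last 2 first.
  - by apply/measurable_EFinP.
  - by rewrite lee_fin ltW.
  by rewrite integral_indic// setIT /= lebesgue_measure_itv/= lte_fin cd -EFinB -EFinM.
have b0 x : 0 <= b x by apply: le_trans (hb x).
have intb : (@lebesgue_measure R).-integrable setT (EFin \o b).
  apply/integrableP; split; first by apply/measurable_EFinP; apply: measurable_funM.
  under eq_integral do rewrite /= ger0_norm ?b0//.
  by rewrite Ib ltry.
have inth : (@lebesgue_measure R).-integrable setT (EFin \o h).
  apply: le_integrable intb => //; first exact/measurable_EFinP.
  by move=> x _ /=; rewrite lee_fin (ger0_norm (b0 x)).
have h0 x : (c <= x < d) \/ h x = 0.
  by case: (boolP (c <= x < d)) => [|/hsupp]; [left|right].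
have hb' x : - del <= h x <= del by rewrite -ler_norml.
have [s [tau [s0 tau0 H1 H2 H]]] := Hw t t0.
rewrite -[leRHS]fineK//.
set A := F tau + _ in H.
have g00 x : 0 <= (if (0 < x) && (x < tau) then u x - s else 0).
  by case: ifPn => // /andP[x0 xt]; rewrite subr_ge0; exact: H1.
have ue x : 0 < x -> u x - s <= if (0 < x) && (x < tau) then u x - s else 0.
  move=> x0; rewrite x0/=; case: ltP => // tx; rewrite subr_le0; exact: H2.
case: H => [[Hs HG]|[dtau Hs HG]|HG].
- apply: (@le_trans _ _ (A + 0)%:E); last by rewrite addr0 lee_fin.
  apply: (@integral_rearr_perturbed _ _ _ _ (cst 0)) => //; first exact: ltW.
  + exact: integrable0.
  + exact: integral0.
  + by move=> x /=; rewrite addr0; exact: g00.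
  + move=> x x0 xD; rewrite addr0 ge_max g00 andbT.
    have [xcd|->] := h0 x.
      have := Hs x xcd; have := u0 x; have := hb' x.
      move=> /andP[? ?] ? ?; apply: le_trans (g00 x); rewrite subr_le0.
      rewrite ler_norml; apply/andP; split; lra.
    by rewrite addr0 ger0_norm//; exact: ue.
- apply: (@le_trans _ _ (A + 0)%:E); last by rewrite addr0 lee_fin.
  have key x : 0 < x -> Num.max (`|u x + h x| - s) 0 <=
      (if (0 < x) && (x < tau) then u x - s else 0) + h x.
    move=> x0; have [xcd|->] := h0 x.
      have /andP[cx xd] := xcd.
      rewrite x0 (lt_le_trans xd dtau) /=.
      have := Hs x xcd; have /andP[? ?] := hb' x => ?.
      rewrite ger0_norm; last lra.
      by rewrite ge_max; apply/andP; split; lra.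
    by rewrite !addr0 ger0_norm// ge_max g00 andbT; exact: ue.
  apply: (@integral_rearr_perturbed _ _ _ _ h) => //; first exact: ltW.
  + move=> x; have [x0|x0] := pselect (0 < x).
      by apply: le_trans (key x x0); rewrite le_max lexx orbT.
    rewrite hsupp ?addr0; first exact: g00.
    by apply/negP => /andP[cx _]; apply: x0; exact: lt_le_trans cx.
  + by move=> x x0 _; exact: key.
- apply: (@le_trans _ _ (A + del * (d - c))%:E); last by rewrite lee_fin.
  apply: (@integral_rearr_perturbed _ _ _ _ b) => //; first exact: ltW.
  + by move=> x; rewrite addr_ge0//; exact: g00.
  + move=> x x0 xD; rewrite ge_max; apply/andP; split; last first.
      by rewrite addr_ge0//; exact: g00.
    apply: le_trans (lerD (ue x x0) (hb x)).
    have := ler_normD (u x) (h x); rewrite (ger0_norm (u0 x)); lra.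
Qed.

(** The bounds [eta] and [e] leave room to make the perturbations small enough
    to belong to the space. *)
Lemma exists_window (R : realType) (alpha : \bar R) (f g : R -> R[i]) (t eta e : R) :
  (0 < alpha)%E ->
  locally_integrable_rearr alpha f -> locally_integrable_rearr alpha g ->
  submajorized alpha f g -> 0 <= t -> rearr alpha f t <> rearr alpha g t ->
  0 < eta -> 0 < e ->
  exists c d del, [/\ 0 < c < d, (d%:E <= alpha)%E, d - c <= eta, 0 < del <= e &
    forall h : R -> R, measurable_fun setT h -> (forall x, `|h x| <= del) ->
      (forall x, ~~ (c <= x < d) -> h x = 0) ->
      (\int[@lebesgue_measure R]_x (h x)%:E)%E = 0%E ->
      submajorized alpha
        (fun x => (fine (rearr alpha f x) + h x)%:C%C) g].
Proof.
move=> a0 lf lg fg t0 neq eta0 e0.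
have [c [c0 ca Fc]] := rearr_primitive_lt (ltW a0) lf lg fg t0 neq.
have [b0 cb0 b0a] : exists2 b, c < b & (b%:E <= alpha)%E.
  case: (alpha) ca => [q| |]// ca.
    by exists q => //; rewrite -lte_fin.
  by exists (c + 1); rewrite ?leey// ltrDl.
pose b := Num.min b0 (c + eta).
have cb : c < b by rewrite lt_min cb0 ltrDl eta0.
have ba : (b%:E <= alpha)%E.
  by apply: le_trans b0a; rewrite lee_fin ge_min lexx.
have FG x : 0 < x -> rearr_primitive alpha f x <= rearr_primitive alpha g x.
  exact: rearr_primitive_le lf lg fg.
have [d [del [/andP[cd db] /andP[del0 dele] H]]] :=
  perturbation_window (rearr_primitiveP lf) (rearr_primitiveP lg) FG c0 cb e0 Fc.
have da : (d%:E <= alpha)%E by apply: le_trans ba; rewrite lee_fin.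
exists c, d, del; split.
- by rewrite c0 cd.
- exact: da.
- have : b <= c + eta by rewrite ge_min lexx orbT.
  by move: db; clear; lra.
- by rewrite del0 dele.
move=> h mh hdel hsupp ih.
exact: (perturbed_submajorized lf lg c0 cd del0 mh hdel hsupp ih H).
Qed.

(** * Balanced step functions *)

Definition cell (R : realType) (c l : R) (j : nat) : set R :=
  `[c + j%:R * l, c + j.+1%:R * l[%classic.

Definition step_fun (R : realType) (c l : R) (n : nat) (a : 'I_n -> R) (x : R) : R :=
  \sum_(j < n) a j * \1_(cell c l j) x.

Lemma cell_disjoint (R : realType) (c l x : R) (i j : nat) : 0 < l ->
  cell c l i x -> cell c l j x -> i = j.
Proof.
move=> l0; rewrite /cell /= !in_itv/= => /andP[ix xi] /andP[jx xj].
have lt m p : c + m%:R * l <= x -> x < c + p.+1%:R * l -> (m <= p)%N.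
  move=> mx xp; have := le_lt_trans mx xp.
  by rewrite ltrD2l ltr_pM2r// ltr_nat ltnS.
by apply/eqP; rewrite eqn_leq !lt.
Qed.

Lemma step_fun_in (R : realType) (c l : R) (n : nat) (a : 'I_n -> R) (i : 'I_n) (x : R) :
  0 < l -> cell c l i x -> step_fun c l a x = a i.
Proof.
move=> l0 ix; rewrite /step_fun (bigD1 i)//= indicE mem_set// mulr1.
rewrite big1 ?addr0// => j ji; rewrite indicE memNset ?mulr0// => jx.
by move/eqP: ji; apply; apply/val_inj; exact: cell_disjoint jx ix.
Qed.

Lemma step_fun_out (R : realType) (c l : R) (n : nat) (a : 'I_n -> R) (x : R) :
  (forall i : 'I_n, ~ cell c l i x) -> step_fun c l a x = 0.
Proof.
by move=> nx; rewrite /step_fun big1// => j _; rewrite indicE memNset ?mulr0.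
Qed.

Lemma measurable_step_fun (R : realType) (c l : R) (n : nat) (a : 'I_n -> R) :
  measurable_fun setT (step_fun c l a).
Proof.
apply: measurable_sum => j; apply: measurable_funM => //.
by apply: measurable_indic; exact: measurable_itv.
Qed.

Lemma integral_step_fun (R : realType) (c l : R) (n : nat) (a : 'I_n -> R) :
  0 <= l ->
  (\int[@lebesgue_measure R]_x (step_fun c l a x)%:E)%E = ((\sum_j a j) * l)%:E.
Proof.
move=> l0.
have mI j : measurable (cell c l j : set (measurableTypeR R)) by exact: measurable_itv.
have muI j : lebesgue_measure (cell c l j) = l%:E.
  rewrite lebesgue_measure_itv/= lte_fin ltrD2l.
  have E : c + j.+1%:R * l - (c + j%:R * l) = l by rewrite -natr1; ring.
  case: ltP => jl; first by rewrite -EFinB E.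
  rewrite (_ : l = 0)//; apply/eqP; rewrite eq_le l0 andbT -E; lra.
have iI (j : 'I_n) : (@lebesgue_measure R).-integrable setT
    (fun x => (\1_(cell c l j) x)%:E)%E.
  exact: integrable_indic_itv.
have iaI (j : 'I_n) : (@lebesgue_measure R).-integrable setT
    (fun x => (a j)%:E * (\1_(cell c l j) x)%:E)%E.
  exact: integrableZl.
transitivity (\int[@lebesgue_measure R]_x
    (\sum_(j <- enum 'I_n) (a j)%:E * (\1_(cell c l j) x)%:E))%E.
  by apply: eq_integral => x _; rewrite /step_fun -sumEFin big_enum.
rewrite integral_sum// mulr_suml -sumEFin big_enum; apply: eq_bigr => j _.
by rewrite integralZl// integral_indic// setIT /= muI EFinM.
Qed.

(** [del] times the indicator of the [i]-th cell minus the average of the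
    indicators of all cells, written through its values on the cells. *)
Definition balanced_step (R : realType) (c l del : R) (k : nat) (i : 'I_k.+1) : R -> R :=
  step_fun c l (fun j : 'I_k.+1 => del * ((i == j)%:R - k.+1%:R^-1)).

Section balanced_step.
Context (R : realType) (c l del : R) (k : nat).
Context (l0 : 0 < l) (del0 : 0 <= del).

Lemma balanced_step_in (i j : 'I_k.+1) (x : R) : cell c l j x ->
  balanced_step c l del i x = del * ((i == j)%:R - k.+1%:R^-1).
Proof. by move=> jx; rewrite /balanced_step (step_fun_in _ l0 jx). Qed.

Lemma balanced_step_cases (x : R) :
  (exists j : 'I_k.+1, cell c l j x) \/ forall i : 'I_k.+1, balanced_step c l del i x = 0.
Proof.
have [|H] := pselect (exists j : 'I_k.+1, cell c l j x); [by left|right=> i].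
by apply: step_fun_out => j jx; apply: H; exists j.
Qed.

Lemma normr_balanced_step_le (i : 'I_k.+1) (x : R) : `|balanced_step c l del i x| <= del.
Proof.
have [[j jx]|->] := balanced_step_cases x; last by rewrite normr0.
rewrite (balanced_step_in i jx) normrM (ger0_norm del0) ler_piMr//.
have k0 : 0 <= k.+1%:R^-1 :> R by rewrite invr_ge0.
have k1 : k.+1%:R^-1 <= 1 :> R by rewrite invf_le1 ?ltr0n// ler1n.
move: (k.+1%:R^-1) k0 k1 => q q0 q1.
by rewrite ler_norml; case: (i == j); rewrite ?mulr1n ?mulr0n; apply/andP; split; lra.
Qed.

Lemma balanced_step_support (i : 'I_k.+1) (x : R) :
  ~~ (c <= x < c + k.+1%:R * l) -> balanced_step c l del i x = 0.
Proof.
move=> xN; have [[j]|//] := balanced_step_cases x.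
rewrite /cell /= in_itv/= => /andP[jx xj]; case/negP: xN; apply/andP; split.
  by apply: le_trans jx; rewrite lerDl mulr_ge0// ltW.
apply: lt_le_trans xj _; rewrite lerD2l ler_wpM2r ?(ltW l0)//.
by rewrite ler_nat.
Qed.

Lemma sum_balanced_step (x : R) : \sum_(i < k.+1) balanced_step c l del i x = 0.
Proof.
have [[j jx]|H] := balanced_step_cases x; last by rewrite big1.
under eq_bigr => i _ do rewrite (balanced_step_in i jx).
rewrite -mulr_sumr sumrB sumr_const card_ord (bigD1 j)//= eqxx big1; last first.
  by move=> i /negbTE ->.
by rewrite addr0 -[_^-1 *+ _]mulr_natl divff ?subrr ?mulr0// pnatr_eq0.
Qed.

Lemma integral_balanced_step (i : 'I_k.+1) :
  (\int[@lebesgue_measure R]_x (balanced_step c l del i x)%:E)%E = 0%E.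
Proof.
rewrite /balanced_step (integral_step_fun _ _ (ltW l0)).
rewrite -mulr_sumr sumrB sumr_const card_ord (bigD1 i)//= eqxx big1; last first.
  by move=> j; rewrite eq_sym => /negbTE ->.
rewrite addr0 -[_^-1 *+ _]mulr_natl divff ?subrr ?mulr0 ?mul0r//.
Qed.

(** Near [0] the steps vanish and [u] does not, so the [a i] add up to zero.
    On the [i]-th cell everything but [del * a i] is then a multiple of
    their sum. *)
Lemma balanced_step_independent (u : R -> R) (a : 'I_k.+1 -> R[i]) :
  0 < c -> 0 < del -> (exists2 e, 0 < e & forall x, 0 < x < e -> 0 < u x) ->
  {ae @lebesgue_measure R, forall x, 0 <= x < c + k.+1%:R * l ->
    \sum_i a i * (u x + balanced_step c l del i x)%:C%C = 0} ->
  forall i, a i = 0.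
Proof.
move=> c0 del_gt0 [e e0 ue] ae i.
have k0 : 0 < k.+1%:R * l by rewrite mulr_gt0.
have sum0 : \sum_i a i = 0.
  have m0 : 0 < Num.min e c by rewrite lt_min e0.
  have [x /andP[x0]] := ae_pick m0 ae.
  rewrite lt_min => /andP[xe xc] H.
  have xD : 0 <= x < c + k.+1%:R * l by apply/andP; split; lra.
  have := H xD.
  under eq_bigr => j _.
    rewrite balanced_step_support; last by rewrite negb_and -ltNge xc.
    rewrite addr0; over.
  rewrite -mulr_suml => /eqP; rewrite mulf_eq0 => /orP[/eqP //|].
  by move=> /eqP[ux]; move: (ue x); rewrite ux ltxx x0 xe => /(_ isT).
have il : c + i%:R * l < c + i.+1%:R * l by rewrite ltrD2l ltr_pM2r// ltr_nat.
have [x /andP[ix xi] H] := ae_pick il ae.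
have jx : cell c l i x by rewrite /cell/= in_itv/= (ltW ix) xi.
have xD : 0 <= x < c + k.+1%:R * l.
  apply/andP; split.
    have : 0 <= i%:R * l by rewrite mulr_ge0// ltW.
    lra.
  apply: lt_le_trans xi _; rewrite lerD2l ler_wpM2r ?(ltW l0)//.
  by rewrite ler_nat.
have := H xD; set b := u x - del * k.+1%:R^-1.
under eq_bigr => j _.
  rewrite (balanced_step_in j jx).
  rewrite (_ : _ * (_)%:C%C = a j * b%:C%C + (if j == i then a j * del%:C%C else 0)).
    over.
  rewrite /b; case: (j == i) => /=.
    by rewrite -mulrDr -rmorphD/=; congr (_ * _%:C%C); ring.
  by rewrite addr0; congr (_ * _%:C%C); ring.
rewrite big_split/= -mulr_suml sum0 mul0r add0r -big_mkcond big_pred1_eq.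
move=> /eqP; rewrite mulf_eq0 => /orP[/eqP //|].
by move=> /eqP[dE]; move: del_gt0; rewrite dE ltxx.
Qed.

End balanced_step.

(** * Strongly symmetric spaces *)

Section space.
Context (R : realType) (alpha : \bar R) (E : banach_function_space alpha).

(** If one integral is infinite, then so are all of them, since the
    rearrangement is bounded away from [0]. Then [g] submajorizes every
    element of [E], which bounds all norms by [|g|] and contradicts the
    presence of multiples of [f]. *)
Lemma strongly_symmetric_locally_integrable :
  strongly_symmetric_space E -> forall f g : E, `|f| = 1 ->
  locally_integrable_rearr alpha (rep g).
Proof.
move=> [_ hE] f g f1 t; rewrite ltey; apply/eqP => goo.
have t0 : 0 < t.
  rewrite ltNge; apply/negP; rewrite le_eqVlt => /orP[/eqP t0|t0].
    by move: goo; rewrite t0 set_itv1 integral_set1.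
  by move: goo; rewrite set_itv_ge ?integral_set0// bnd_simp -ltNge.
have all t' : 0 < t' ->
    (\int[@lebesgue_measure R]_(s in `[0%R, t']) rearr alpha (rep g) s)%E = +oo%E.
  move=> t'0; have [tt'|t't] := leP t t'.
    rewrite (integral_rearr_split alpha (rep g) (ltW t0) tt') goo addye//.
    rewrite -ltNye; apply: (@lt_le_trans _ _ 0%E) => //.
    by apply: integral_ge0 => s _; exact: rearr_ge0.
  apply/eqP; rewrite -leye_eq leNgt; apply/negP => fin.
  have gt' : (rearr alpha (rep g) t' < +oo)%E.
    rewrite ltey; apply/eqP => E1; move: fin.
    rewrite (integral_rearr_split alpha (rep g) (lexx 0) (ltW t'0)).
    rewrite set_itv1 integral_set1 add0e ltNge => /negP; apply.
    apply: le_trans (integral_oc_ge alpha (rep g) (ltW t'0)).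
    by rewrite E1 subr0 gt0_muley ?lte_fin.
  have := integral_oc_le alpha (rep g) (ltW t't).
  move: goo; rewrite (integral_rearr_split alpha (rep g) (ltW t'0) (ltW t't)).
  move=> goo Hle.
  have : (\int[@lebesgue_measure R]_(s in `]t', t]) rearr alpha (rep g) s < +oo)%E.
    apply: le_lt_trans Hle _.
    by rewrite -(@fineK _ (rearr alpha (rep g) t')) -?EFinM ?ltry// ge0_fin_numE ?rearr_ge0.
  by move=> fin2; have := lte_add_pinfty fin fin2; rewrite goo ltxx.
have /hE : submajorized alpha (rep ((`|g| + 1) *: f)) (rep g).
  by move=> t' t'0; rewrite all// leey.
rewrite normrZ f1 mulr1 ger0_norm ?addr_ge0//.
by rewrite gerDl ler10.
Qed.

(** Otherwise [f] is submajorized by [0], hence of norm zero. *)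
Lemma rearr_gt0_near0 : strongly_symmetric_space E -> forall f : E, `|f| = 1 ->
  exists2 eta, 0 < eta & (0 < rearr alpha (rep f) eta)%E.
Proof.
move=> [_ hE] f f1; apply: contrapT => H.
have r0 x : 0 < x -> rearr alpha (rep f) x = 0%E.
  move=> x0; apply/eqP; rewrite eq_le rearr_ge0 andbT leNgt.
  by apply/negP => rx; apply: H; exists x.
have /hE : submajorized alpha (rep f) (rep (0 : E)).
  move=> t t0; rewrite (integral_rearr_split alpha (rep f) (lexx 0) (ltW t0)).
  rewrite set_itv1 integral_set1 add0e integral0_eq.
    by apply: integral_ge0 => s _; exact: rearr_ge0.
  by move=> x /=; rewrite in_itv/= => /andP[x0 _]; exact: r0.
by rewrite f1 normr0 ler10.
Qed.

Lemma rep0 : ae_eq_on alpha (rep (0 : E)) (fun=> 0).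
Proof.
have H0 := rep_linear (-1) (0 : E) 0; rewrite scaler0 addr0 in H0.
by apply: (lebesgue_ae H0) => x H xD; rewrite (H xD) mulN1r addNr.
Qed.

Lemma rep_sum (n : nat) (c : 'I_n -> R[i]) (y : 'I_n -> E) :
  ae_eq_on alpha (rep (\sum_i c i *: y i)) (fun t => \sum_i c i * rep (y i) t).
Proof.
elim: n c y => [|n IH] c y.
  rewrite big_ord0; apply: (lebesgue_ae rep0) => x H xD.
  by rewrite big_ord0; exact: H.
rewrite big_ord_recl.
have H1 := rep_linear (c ord0) (y ord0) (\sum_(i < n) c (lift ord0 i) *: y (lift ord0 i)).
have H2 := IH (fun i => c (lift ord0 i)) (fun i => y (lift ord0 i)).
apply: (lebesgue_ae2 H1 H2) => x E1 E2 xD.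
by rewrite E1// E2// big_ord_recl.
Qed.
End space.

(** The triangle inequality for the average leaves no slack. *)
Lemma norm1_of_average (K : numFieldType) (X : normedModType K) (k : nat)
    (z : X) (y : 'I_k.+1 -> X) :
  `|z| = 1 -> (forall i, `|y i| <= 1) -> z = k.+1%:R^-1 *: \sum_i y i ->
  forall i, `|y i| = 1.
Proof.
move=> z1 y1 zy i; apply/eqP; rewrite eq_le y1/=.
have kE : k.+1%:R = `|\sum_i y i|.
  have : k.+1%:R *: z = \sum_i y i.
    by rewrite zy scalerA divff ?scale1r// pnatr_eq0.
  by move=> <-; rewrite normrZ z1 mulr1 ger0_norm.
have H : `|\sum_(j < k.+1 | j != i) y j| <= k%:R.
  apply: le_trans (ler_norm_sum _ _ _) _.
  apply: (@le_trans _ _ (\sum_(j < k.+1 | j != i) 1)); first exact: ler_sum.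
  by rewrite sumr_const cardC1 card_ord.
have := ler_normD (y i) (\sum_(j < k.+1 | j != i) y j).
have <- : \sum_i y i = y i + \sum_(j < k.+1 | j != i) y j by rewrite (bigD1 i).
rewrite -kE => /le_trans/(_ (lerD (lexx _) H)).
by rewrite -natr1 addrC lerD2r.
Qed.

(** * Failure of k-extremality *)

Unset Implicit Arguments.

Theorem theorem2p6 (R : realType) (alpha : \bar R) (alpha_gt0 : (0 < alpha)%E)
    (E : banach_function_space alpha) (hE : strongly_symmetric_space E)
    (k : nat) (f : E) (hf : `|f| = 1)
    (hg : exists g : E, [/\ `|g| = 1,
        submajorized alpha (rep f) (rep g) &
        exists2 t : R, 0 <= t &
          rearr alpha (rep f) t <> rearr alpha (rep g) t]) :
  exists2 z : E, ae_eq_on alpha (rep z) (rearr_fun alpha (rep f)) &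
    ~ k_extreme k z.
Proof.
have [g [g1 fg [t t0 neq]]] := hg.
have lf := strongly_symmetric_locally_integrable hE f hf.
have lg := strongly_symmetric_locally_integrable hE g hf.
have [eta eta0 reta] := rearr_gt0_near0 hE hf.
pose u := fine \o rearr alpha (rep f).
have dF := rearr_primitiveP lf.
have fin_eta : rearr alpha (rep f) eta \is a fin_num by exact: rearr_fin_num.
have ueta : 0 < u eta by rewrite -lte_fin /u/= fineK.
have [c [d [del [/andP[c0 cd] da dceta /andP[del0 dele] Hsub]]]] :=
  exists_window alpha_gt0 lf lg fg t0 neq eta0 ueta.
pose l := (d - c) / k.+1%:R.
have l0 : 0 < l by rewrite /l divr_gt0// subr_gt0.
have dE : c + k.+1%:R * l = d.
  by rewrite /l mulrCA divff ?pnatr_eq0// mulr1 addrC subrK.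
pose h (i : 'I_k.+1) := balanced_step c l del i.
have mh i : measurable_fun setT (h i) by exact: measurable_step_fun.
have hdel i x : `|h i x| <= del by apply: normr_balanced_step_le; [exact: l0|exact: ltW].
have hsupp i x : ~~ (c <= x < d) -> h i x = 0.
  by move=> xN; apply: balanced_step_support; [exact: l0|rewrite dE].
have ih i : (\int[@lebesgue_measure R]_x (h i x)%:E)%E = 0%E.
  exact: integral_balanced_step.
have [z zE _] := hE.1 _ f (L0_real alpha (measurable_fine_rearr alpha (rep f)))
  (fun t _ => rearr_rearr_fun_le alpha (rep f) t).
exists z; first exact: zE.
have delr : (del%:E <= rearr alpha (rep f) eta)%E by rewrite -(fineK fin_eta) lee_fin.
have /choice[b bE] (i : 'I_k.+1) :
    exists x : E, ae_eq_on alpha (rep x) (fun x => (h i x)%:C%C).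
  have [x xE _] := hE.1 _ f (L0_real alpha (mh i)) (fun t t0 =>
    rearr_bump_le (ltW cd) dceta (ltW del0) delr (hdel i) (hsupp i) t0).
  by exists x.
have b0 : \sum_i b i = 0.
  apply: rep_inj.
  have s1 := rep_sum (fun _ : 'I_k.+1 => 1) b.
  have e1 : \sum_i 1 *: b i = \sum_i b i by apply: eq_bigr => i _; rewrite scale1r.
  rewrite e1 in s1.
  apply: (lebesgue_ae2 (lebesgue_ae2 (rep0 E) s1 (fun x => @conj _ _))
    (lebesgue_ae_forall bE)) => x [x0 x1] xb xD.
  rewrite x0// x1//.
  under eq_bigr => i _ do rewrite mul1r xb//.
  by rewrite -rmorph_sum/= sum_balanced_step.
(* the factor [1] puts the sum into the shape of [rep_linear] *)
pose y i := 1 *: z + b i.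
have yE i : ae_eq_on alpha (rep (y i)) (fun x => (u x + h i x)%:C%C).
  apply: (lebesgue_ae2 (rep_linear 1 z (b i)) (lebesgue_ae2 zE (bE i) (fun x => @conj _ _))).
  by move=> x x1 [xz xb] xD; rewrite x1// xz// xb// mul1r rmorphD.
have y_le1 i : `|y i| <= 1.
  rewrite -g1; apply: hE.2; rewrite /submajorized (eq_rearr (yE i)).
  exact: (Hsub _ (mh i) (hdel i) (hsupp i) (ih i)).
have zy : z = k.+1%:R^-1 *: \sum_i y i.
  have -> : \sum_i y i = k.+1%:R *: z.
    by rewrite big_split/= b0 addr0 sumr_const card_ord scale1r scaler_nat.
  by rewrite scalerA mulVf ?scale1r// pnatr_eq0.
move=> [z1 /(_ y (norm1_of_average z1 y_le1 zy) zy)[a [i ai0] sum0]].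
move/eqP: ai0; apply; move: i.
apply: (balanced_step_independent (u := u) l0 c0 del0).
  exists eta => // x /andP[x0 xeta]; apply: lt_le_trans ueta _.
  exact: dp_noninc dF _ _ x0 (ltW xeta).
have sa := rep_sum a y; rewrite sum0 in sa.
apply: (lebesgue_ae2 (lebesgue_ae2 (rep0 E) sa (fun x => @conj _ _))
    (lebesgue_ae_forall yE)) => x [x0 x1] xy; rewrite dE => /andP[x_ge0 xd].
have xD : dom alpha x.
  by split => //; apply: lt_le_trans da; rewrite lte_fin.
transitivity (rep (0 : E) x).
  by rewrite x1//; apply: eq_bigr => i _; rewrite xy.
exact: x0.
Qed.
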